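(* Let $M\ge 1$, $T>0$, let $\mathcal{S}\subset\mathbb{R}$ be a finite set with $|\mathcal{S}|>2M$, and let $P$ be a positive finite measure on $\mathcal{S}$ (giving strictly positive mass to each point of $\mathcal{S}$). Let $\psi(s,t)=e^{-(s-t)^2}$. Then for any real $t_1<\dots<t_M$, the function $\psi$ satisfies the four conditions INTEGRABILITY, POSITIVITY, INDEPENDENCE and DETERMINANTAL stated in the context.
   Context: $\frac{d}{dt_i}\psi(s,t_i)$ denotes the partial derivative of $\psi$ in its second argument evaluated at $(s,t_i)$. $L^2_P$ is the space of functions square-integrable with respect to $P$. Define $w(t)=\int\psi(s,t)\,dP(s)$, $$v(s)=\begin{bmatrix}\psi(s,t_1)&\cdots&\psi(s,t_M)&\frac{d}{dt_1}\psi(s,t_1)&\cdots&\frac{d}{dt_M}\psi(s,t_M)\end{bmatrix}^T\in\mathbb{R}^{2M},$$ $$\kappa(t)=\frac{1}{w(t)}\int\psi(s,t)\,v(s)\,dP(s)\in\mathbb{R}^{2M},$$ $$\Lambda(p_1,\dots,p_{2M+1})=\begin{bmatrix}\kappa(p_1)&\cdots&\kappa(p_{2M+1})\\1&\cdots&1\end{bmatrix}\in\mathbb{R}^{(2M+1)\times(2M+1)}.$$ The four conditions on $\psi$ are: INTEGRABILITY: $\psi(\cdot,t)\in L^2_P$ for every $t$. POSITIVITY: $w(t)>0$ for all $t\in[-T,T]$. INDEPENDENCE: the matrix $\int v(s)v(s)^T\,dP(s)$ is nonsingular. DETERMINANTAL: there exists $\rho>0$ such that for any $t_i^-,t_i^+\in(t_i-\rho,t_i+\rho)$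 ($i=1,\dots,M$) and any $t\in[-T,T]$, the matrix $\Lambda(t_1^-,t_1^+,\dots,t_M^-,t_M^+,t)$ is nonsingular whenever $t,t_1^-,t_1^+,\dots,t_M^-,t_M^+$ are distinct. *)

(* Defs.v *)
From HB Require Import structures.
From mathcomp Require Import all_boot all_order all_algebra finmap.
From mathcomp Require Import all_classical all_reals all_analysis.
Set Implicit Arguments.
Unset Strict Implicit.
Unset Printing Implicit Defensive.
Import Order.TTheory GRing.Theory Num.Theory.
Import numFieldNormedType.Exports.
Local Open Scope classical_set_scope.
Local Open Scope ring_scope.

(* Vectors in R^(2M) are indexed by 'I_(M + M).  The integrals below are
   real-valued Lebesgue integrals, so they have their intended meaning only when
   the integrands are P-integrable; this is automatic for the Gaussian, where
   the integrands are bounded on the finite support of P. *)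
Section conditions.
Context {R : realType} {M : nat}.
Variables (P : {measure set (measurableTypeR R) -> \bar R}).
Variables (psi : R -> R -> R) (t : 'I_M -> R).

Definition weight (u : R) : R := \int[P]_s psi s u.

Definition vvec (s : R) : 'cV[R]_(M + M) :=
  col_mx (\col_i psi s (t i)) (\col_i derive1 (psi s) (t i)).

Definition kappa (u : R) : 'cV[R]_(M + M) :=
  (weight u)^-1 *: \col_i \int[P]_s (psi s u * vvec s i 0).

Definition Lambda (p : 'I_(M + M + 1) -> R) : 'M[R]_(M + M + 1) :=
  col_mx (\matrix_(i, j) kappa (p j) i 0) (const_mx 1).

Definition gram : 'M[R]_(M + M) :=
  \matrix_(i, j) \int[P]_s ((vvec s *m (vvec s)^T) i j).

(* The list t_1^-, t_1^+, ..., t_M^-, t_M^+, u, of length 2M + 1. *)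
Definition points (tm tp : 'I_M -> R) (u : R) : seq R :=
  rcons (flatten [seq [:: tm i; tp i] | i <- enum 'I_M]) u.

Definition integrability : Prop :=
  forall u : R, (fun s => psi s u) \in Lfun P 2%:E.

Definition positivity (T : R) : Prop :=
  forall u : R, -T <= u <= T -> 0 < weight u.

Definition independence : Prop := gram \in unitmx.

Definition determinantal (T : R) : Prop :=
  exists2 rho : R, 0 < rho &
    forall tm tp : 'I_M -> R,
      (forall i, t i - rho < tm i < t i + rho) ->
      (forall i, t i - rho < tp i < t i + rho) ->
    forall u : R, -T <= u <= T ->
      uniq (points tm tp u) ->
      Lambda (fun j => nth 0 (points tm tp u) j) \in unitmx.

End conditions.

Definition gaussian_psf {R : realType} (s t : R) : R := expR (- (s - t) ^+ 2).

(* Main.v *)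
From HB Require Import structures.
Require Import Defs.
From mathcomp Require Import all_boot all_order all_algebra finmap.
From mathcomp Require Import all_classical all_reals all_analysis.
From mathcomp Require Import measurable_realfun.
From mathcomp Require Import zify ring lra.
Set Implicit Arguments.
Unset Strict Implicit.
Unset Printing Implicit Defensive.
Import Order.TTheory GRing.Theory Num.Theory.
Import numFieldNormedType.Exports.
Local Open Scope classical_set_scope.
Local Open Scope ring_scope.

(** The measure [P] is a sum of positive point masses, so all integrals are
finite sums over [S]; integrability and positivity follow at once.  The other
two conditions say that a linear combination of the components of [v] and of
the constant 1, with coefficients (c, g), must have zero coefficients as soon
as it is orthogonal to certain functions.  After multiplication by e^{s^2}
such a combination becomes

    f(s) = sum_i P_i(s) e^{2 t_i s} + g e^{s^2},    deg P_i <= 1,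

and everything rests on two facts.

(1) A nonzero f has at most 2M real zeros ([expgauss_zeros]).  By Rolle's
theorem applied to e^{-bs} f, the operator D - b destroys at most one zero
([rolle_iter]).  The product of all the (D - 2 t_i)^2 kills the exponential
part and sends e^{s^2} to r(D)^2 e^{s^2}, where r is the product of the
X - 2 t_i.  The latter is positive everywhere ([gsymb_sqr_gt0]):
e^{-s^2} r(D) e^{s^2} is the mean of r at a Gaussian variable of mean 2s and
variance 2, so that r^2 has a positive mean.  This mean is treated purely
algebraically, through its integration by parts formula and the orthogonal
(Hermite) polynomials it yields.  Hence g = 0; the polynomials P_i are then
shown to vanish by killing all the exponentials but one.

(2) If the exponential sum G(x) = sum_s p_s f(s) e^{sx}, with p_s > 0, has more
zeros than f, then f vanishes at every s ([expsum_sign_changes]).  Otherwise,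
between consecutive points where f has opposite signs choose a zero z of f:
the product of f(s) and of all the s - z has a constant sign
([sign_by_zeros]).  Applying the product of the D - z to G makes all the
coefficients of this sign, so the result has no zero, although Rolle's theorem
leaves it at least one.

For the Gram matrix, a vector of its kernel gives an f vanishing on [S], and
(1) concludes since [S] has more than 2M points.  For [Lambda], a vector of the
left kernel gives a combination orthogonal to the Gaussians centred at the
2M + 1 points, that is, a G vanishing at the doubles of these points; as they
are distinct, (1) and (2) show that it is zero, whatever the value of rho. *)

(** * Powers of the derivation on exp(s^2) and Hermite orthogonality *)

Section gauss_symbol.
Context {R : realFieldType}.
Implicit Types (p q : {poly R}).

(** The n-th derivative of exp(s^2) is [dexp_poly n] times exp(s^2). *)
Fixpoint dexp_poly (n : nat) : {poly R} :=
  if n is m.+1 then 'X *+ 2 * dexp_poly m + (dexp_poly m)^`() else 1.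

(** The symbol of the differential operator p(D) at exp(s^2): p(D) exp(s^2) is
[gsymb p] times exp(s^2). *)
Definition gsymb p : {poly R} := \sum_(i < size p) p`_i *: dexp_poly i.

Lemma gsymb_wide n p : (size p <= n)%N ->
  gsymb p = \sum_(i < n) p`_i *: dexp_poly i.
Proof.
move=> le_pn; rewrite /gsymb (big_ord_widen n (fun i => p`_i *: dexp_poly i))//.
rewrite [RHS](bigID (fun i : 'I_n => (i < size p)%N))/=.
rewrite [X in _ + X]big1 ?addr0//.
by move=> i; rewrite -leqNgt => /(nth_default 0) ->; rewrite scale0r.
Qed.

Lemma gsymb_linear : linear gsymb.
Proof.
move=> a p q; pose n := maxn (size (a *: p + q)) (maxn (size p) (size q)).
rewrite !(@gsymb_wide n) /n ?leq_max ?leqnn ?orbT//.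
rewrite scaler_sumr -big_split/=; apply: eq_bigr => i _.
by rewrite coefD coefZ scalerDl scalerA.
Qed.

HB.instance Definition _ := GRing.isLinear.Build R {poly R} {poly R} _ gsymb
  gsymb_linear.

Lemma gsymbC c : gsymb c%:P = c%:P.
Proof.
by rewrite (@gsymb_wide 1) ?size_polyC_leq1// big_ord1 coefC/= alg_polyC.
Qed.

(** Multiplying p by X composes p(D) with D, and D (q exp(s^2)) is
(2 X q + q') exp(s^2). *)
Lemma gsymb_mulX p : gsymb (p * 'X) = 'X *+ 2 * gsymb p + (gsymb p)^`().
Proof.
rewrite (@gsymb_wide (size p).+1); last first.
  by rewrite (leq_trans (size_polyMleq _ _))// size_polyX addn2.
rewrite big_ord_recl coefMX/= scale0r add0r /gsymb raddf_sum.
rewrite mulr_sumr -big_split/=.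
by apply: eq_bigr => i _; rewrite coefMX/= derivZ scalerDr scalerAr.
Qed.

(** Differentiating p(D) exp(s^2) in two ways: D p(D) = (X p)(D), while moving
the factor 2s out of p(D) (2s exp(s^2)) produces the commutator 2 p'(D). *)
Lemma deriv_gsymb p : (gsymb p)^`() = gsymb p^`() *+ 2.
Proof.
elim/poly_ind: p => [|p c IH]; first by rewrite linear0 derivC linear0 mul0rn.
rewrite derivD derivC addr0 derivM derivX mulr1.
rewrite !linearD/= gsymbC derivC addr0 !gsymb_mulX derivD derivM IH derivMn.
by rewrite derivX derivMn; ring.
Qed.

End gauss_symbol.

Section gaussian_functional.
(* The hypothesis [E_mulX] is the integration by parts formula of a Gaussian
   variable of mean c and variance 2; with [E1] it determines E, which is the
   mean of a polynomial at this variable. *)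
Context {R : realFieldType} (c : R) (E : {linear {poly R} -> R | *%R}).
Hypothesis E1 : E 1 = 1.
Hypothesis E_mulX : forall p, E (p * 'X) = c * E p + E p^`() *+ 2.

(** The monic Hermite polynomials of the Gaussian of mean c and variance 2. *)
Fixpoint orthpoly (n : nat) : {poly R} :=
  if n is m.+1 then orthpoly m * ('X - c%:P) - (orthpoly m)^`() *+ 2 else 1.

Lemma coef_orthpoly n j : (n <= j)%N -> (orthpoly n)`_j = (j == n)%:R.
Proof.
elim: n j => [|n IH] [|j]//= le_nj; rewrite ?coef1// coefB coefMn coef_deriv.
have lt1 : (n < j.+1)%N by [].
have lt2 : (n < j.+2)%N := leqW lt1.
rewrite mulrBr coefB coefMX [_ * c%:P]mulrC coefCM/=.
rewrite !IH// ?(ltnW lt1) ?(ltnW lt2)//.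
by rewrite (gtn_eqF lt1) (gtn_eqF lt2) mulr0 !mul0rn !subr0 eqSS.
Qed.

Lemma size_orthpoly_subXn n : (size (orthpoly n - 'X^n)%R <= n)%N.
Proof.
by apply/leq_sizeP => j le_nj; rewrite coefB coef_orthpoly// coefXn subrr.
Qed.

(** The recurrence defining [orthpoly] is made so that one integration by parts
turns [orthpoly n.+1 * r] into twice [orthpoly n * r^`()]. *)
Lemma gauss_mean_orthpoly n r : E (orthpoly n * r) = 2 ^+ n * E r^`(n).
Proof.
elim: n r => [|n IH] r; first by rewrite !mul1r derivn0.
have -> : orthpoly n.+1 * r = orthpoly n * r * 'X - c *: (orthpoly n * r)
    - ((orthpoly n)^`() * r) *+ 2.
  by rewrite /= -mul_polyC; ring.
rewrite derivSn !linearB/= linearZ/= linearMn/= E_mulX derivM linearD/= !IH.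
by rewrite exprS; ring.
Qed.

(** Splitting off the leading Hermite component of p reduces the degree: the
cross term vanishes by orthogonality, and the square of a Hermite polynomial has
a positive mean. *)
Lemma gauss_mean_sqr_ge0 n (p : {poly R}) :
  (size p <= n)%N -> 0 <= E (p ^+ 2) ?= iff (p == 0).
Proof.
elim: n p => [|n IH] p le_pn.
  move: le_pn; rewrite leqn0 size_poly_eq0 => /eqP ->.
  by rewrite expr0n/= linear0 eqxx; apply/leifP.
pose q := p - p`_n *: orthpoly n.
have E_low (r : {poly R}) : (size r <= n)%N -> E (orthpoly n * r) = 0.
  by move=> le_rn; rewrite gauss_mean_orthpoly derivn_poly0// linear0 mulr0.
have le_qn : (size q <= n)%N.
  apply/leq_sizeP => j le_nj; rewrite coefB coefZ coef_orthpoly//.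
  case: eqVneq => [->|neq_jn]; first by rewrite mulr1 subrr.
  have lt_nj : (n < j)%N by rewrite ltn_neqAle eq_sym neq_jn.
  by rewrite mulr0 subr0 (nth_default 0 (leq_trans le_pn lt_nj)).
(* Only the leading monomial of the second factor matters, by [E_low]. *)
have E_orthpoly_sqr : E (orthpoly n ^+ 2) = (2 ^ n * n`!)%:R.
  rewrite expr2 -[X in _ * X](subrK 'X^n) mulrDr linearD/=.
  rewrite E_low ?size_orthpoly_subXn// add0r.
  rewrite gauss_mean_orthpoly derivnXn subnn expr0 ffactnn linearMn/= E1.
  by rewrite natrM natrX.
have -> : E (p ^+ 2) = p`_n ^+ 2 * (2 ^ n * n`!)%:R + E (q ^+ 2).
  rewrite -E_orthpoly_sqr -linearZ/= -linearD/=.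
  have {1}-> : p = q + p`_n *: orthpoly n by rewrite subrK.
  have -> : (q + p`_n *: orthpoly n) ^+ 2 = p`_n ^+ 2 *: orthpoly n ^+ 2 +
     q ^+ 2 + (p`_n *: (orthpoly n * q) + p`_n *: (orthpoly n * q)).
    by rewrite -!mul_polyC; ring.
  by rewrite !linearD/= !linearZ/= E_low// mulr0 !addr0.
have pos : 0 < (2 ^ n * n`!)%:R :> R.
  by rewrite ltr0n muln_gt0 expn_gt0 fact_gt0.
have [Eq_ge0 Eq_eq0] := IH q le_qn; rewrite eq_sym in Eq_eq0.
apply/leifP; case: eqP => [p0|/eqP p_neq0].
  have q0 : q = 0 by rewrite /q p0 coef0 scale0r subr0.
  by rewrite p0 coef0 q0 !expr0n/= linear0 mul0r addr0.
have [pn0|pn_neq0] := eqVneq p`_n 0.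
  rewrite pn0 expr0n mul0r add0r lt0r Eq_ge0 Eq_eq0 andbT.
  by rewrite /q pn0 scale0r subr0.
by rewrite ltr_pwDl// mulr_gt0// exprn_even_gt0.
Qed.
End gaussian_functional.

(** At a fixed s, evaluating [gsymb] gives a functional satisfying the Gaussian
integration by parts formula with mean 2s. *)
Lemma gsymb_sqr_gt0 (R : realFieldType) (p : {poly R}) s :
  p != 0 -> 0 < (gsymb (p ^+ 2)).[s].
Proof.
move=> p_neq0; pose E := horner_eval s \o @gsymb R.
have E1 : E 1 = 1 by rewrite /E/= /horner_eval -polyC1 gsymbC hornerC.
have E_mulX q : E (q * 'X) = s *+ 2 * E q + E q^`() *+ 2.
  by rewrite /E/= /horner_eval gsymb_mulX deriv_gsymb !hornerE; ring.
have [E_ge0 E_eq0] := gauss_mean_sqr_ge0 E1 E_mulX (leqnn (size p)).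
by rewrite [_.[s]](_ : _ = E (p ^+ 2))// lt0r E_ge0 eq_sym E_eq0 p_neq0.
Qed.

(** * Rolle's theorem for the operators D - b *)

Lemma is_derive_continuous (R : realType) (f df : R -> R) :
  (forall u : R, is_derive u 1 f (df u)) -> continuous f.
Proof.
move=> fdf u; apply: differentiable_continuous.
by apply/derivable1_diffP; case: (fdf u).
Qed.

Lemma continuous_mul (R : realType) (f g : R -> R) :
  continuous f -> continuous g -> continuous (fun s => f s * g s).
Proof. by move=> cf cg s; exact: (cvgM (cf s) (cg s)). Qed.

Section zeros.
Context {R : realType}.

(** Rolle's theorem for exp(- a u) f(u), whose derivative is exp(- a u) g(u). *)
Lemma rolle_shift (f g : R -> R) (a x y : R) : x < y ->
  (forall u : R, is_derive u 1 f (g u + a * f u)) -> f x = 0 -> f y = 0 ->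
  exists2 z, x < z < y & g z = 0.
Proof.
move=> lt_xy df fx0 fy0; pose h u := expR (- a * u) * f u.
have dh (u : R) : is_derive u 1 h (expR (- a * u) * g u).
  have df' := df u. rewrite /h; apply: is_derive_eq.
  by rewrite /GRing.scale/=; ring.
have [|||z] := @Rolle R h x y lt_xy.
- by move=> u _; case: (dh u).
- exact/continuous_subspaceT/(is_derive_continuous dh).
- by rewrite /h fx0 fy0 !mulr0.
rewrite in_itv/= => zxy dz; exists z => //.
have /eqP : expR (- a * z) * g z = 0.
  by have [_ <-] := dh z; have [_ ->] := dz.
by rewrite mulf_eq0 gt_eqF ?expR_gt0//= => /eqP.
Qed.

Lemma interlacing_points (Z W : R -> Prop) x l :
  (forall u v, u < v -> Z u -> Z v -> exists2 w, u < w < v & W w) ->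
  path <%R x l -> (forall u, u \in x :: l -> Z u) ->
  exists l' : seq R, [/\ path <%R x l', size l' = size l &
                        forall u, u \in l' -> W u].
Proof.
move=> between; elim: l x => [|y l IH] x /=; first by exists [::].
move=> /andP[lt_xy path_l] Z_l.
have [l' [path_l' size_l' W_l']] : exists l' : seq R, [/\ path <%R y l',
    size l' = size l & forall u, u \in l' -> W u].
  by apply: IH => // u u_l; apply: Z_l; rewrite inE u_l orbT.
have [||w /andP[lt_xw lt_wy] Ww] := between x y lt_xy.
- by apply: Z_l; rewrite inE eqxx.
- by apply: Z_l; rewrite !inE eqxx orbT.
exists (w :: l'); split=> /=; last 2 first.
- by rewrite size_l'.
- by move=> u; rewrite inE => /predU1P[->//|]; exact: W_l'.
by rewrite lt_xw (path_le lt_trans lt_wy).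
Qed.

(** The family F is to be thought of as F bs = (D - b_1) ... (D - b_n) F [::];
each factor loses at most one zero. *)
Lemma rolle_iter (F : seq R -> R -> R) bs (z : seq R) :
  (forall bs b u, is_derive (u : R) 1 (F bs) (F (b :: bs) u + b * F bs u)) ->
  uniq z -> (forall u, u \in z -> F [::] u = 0) ->
  exists z', [/\ uniq z', size z' = (size z - size bs)%N &
                 forall u, u \in z' -> F bs u = 0].
Proof.
move=> dF uniq_z z0; elim: bs => [|b bs [z' [uniq_z' size_z' z'0]]].
  by exists z; rewrite subn0.
have sort_z' : sorted <%R (sort <=%R z').
  by rewrite lt_sorted_uniq_le sort_uniq uniq_z' sort_le_sorted.
have : forall u, u \in sort <=%R z' -> F bs u = 0.
  by move=> u; rewrite mem_sort; exact: z'0.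
have : size (sort <=%R z') = (size z - size bs)%N by rewrite size_sort.
case: (sort <=%R z') sort_z' => [|x l] /= sort_l size_l l0.
  by exists [::]; rewrite subnS -size_l.
have between u v : u < v -> F bs u = 0 -> F bs v = 0 ->
    exists2 w, u < w < v & F (b :: bs) w = 0.
  by move=> lt_uv; apply: rolle_shift lt_uv _ => w; exact: dF.
have [l' [path_l' size_l' l'0]] := interlacing_points between sort_l l0.
exists l'; split => //; last by rewrite subnS -size_l.
exact: lt_sorted_uniq (path_sorted path_l').
Qed.

(** * Zeros of sums of exponentials and of a Gaussian *)

(** The action of the product of the D - b on p(u) exp(e u), read on p. *)
Definition shift_deriv (e : R) bs (p : {poly R}) : {poly R} :=
  foldr (fun b q => q^`() + (e - b) *: q) p bs.

(** A factor D - e differentiates the polynomial, which lowers its degree. *)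
Lemma size_shift_deriv e bs p :
  (size (shift_deriv e bs p) <= size p - count_mem e bs)%N.
Proof.
elim: bs => [|b bs IH] /=; first by rewrite subn0.
set q := shift_deriv e bs p in IH *.
have [->|q_neq0] := eqVneq q 0.
  by rewrite derivC scaler0 addr0 size_poly0.
have lt_q' := lt_size_deriv q_neq0.
have [->|_] := eqVneq b e; rewrite ?subrr ?scale0r ?addr0 ?add0n.
  rewrite addnC subnDA subn1 -ltnS (leq_trans lt_q')//.
  by rewrite (leq_trans IH)// leqSpred.
apply: leq_trans (size_polyD _ _) _; rewrite geq_max.
by rewrite (leq_trans (ltnW lt_q') IH) (leq_trans (size_scale_leq _ _) IH).
Qed.

(** When b differs from e, the term (e - b) q has the degree of q, which exceeds
that of q'. *)
Lemma shift_deriv_eq0 e bs p : e \notin bs ->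
  (shift_deriv e bs p == 0) = (p == 0).
Proof.
elim: bs => [//|b bs IH] /=; rewrite inE negb_or => /andP[neq_eb /IH <-].
set q := shift_deriv e bs p.
have [->|q_neq0] := eqVneq q 0; first by rewrite derivC scaler0 addr0 eqxx.
apply/negbTE; rewrite -size_poly_eq0 addrC size_polyDl size_scale ?subr_eq0//.
  by rewrite size_poly_eq0.
exact: lt_size_deriv.
Qed.

(** The list bs records the operators D - b already applied to the function
[expgauss a P c [::]], which is sum_i P_i(u) exp(a_i u) + c exp(u^2). *)
Definition expgauss M (a : 'I_M -> R) (P : 'I_M -> {poly R}) (c : R)
    (bs : seq R) (u : R) : R :=
  \sum_i (shift_deriv (a i) bs (P i)).[u] * expR (a i * u) +
  (gsymb (c *: \prod_(b <- bs) ('X - b%:P))).[u] * expR (u ^+ 2).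

Lemma is_derive_expgauss M (a : 'I_M -> R) P c bs b (u : R) :
  is_derive u 1 (expgauss a P c bs)
    (expgauss a P c (b :: bs) u + b * expgauss a P c bs u).
Proof.
pose f i v := (shift_deriv (a i) bs (P i)).[v] * expR (a i * v).
pose g v := (gsymb (c *: \prod_(b <- bs) ('X - b%:P))).[v] * expR (v ^+ 2).
have -> : expgauss a P c bs = \sum_i f i + g.
  by apply/funext => v; rewrite /expgauss fctE fct_sumE.
have df i : is_derive u 1 (f i)
    ((shift_deriv (a i) (b :: bs) (P i)).[u] * expR (a i * u) + b * f i u).
  rewrite /f; apply: is_derive_eq; rewrite /= !hornerE /GRing.scale/=; ring.
have dg : is_derive u 1 g
    ((gsymb (c *: \prod_(b <- b :: bs) ('X - b%:P))).[u] * expR (u ^+ 2) +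
      b * g u).
  rewrite /g; apply: is_derive_eq; rewrite big_cons; set r := \prod_(b <- bs) _.
  have -> : c *: (('X - b%:P) * r) = (c *: r) * 'X - b *: (c *: r).
    by rewrite -!mul_polyC; ring.
  rewrite linearB/= [gsymb (b *: _)]linearZ/= gsymb_mulX !hornerE.
  by rewrite /GRing.scale/=; ring.
apply: is_derive_eq.
by rewrite /expgauss fctE fct_sumE big_split/= -mulr_sumr mulrDr; ring.
Qed.

(** Applying the product of the (D - a_i)^2 leaves only a positive multiple of c
exp(u^2), but preserves a zero, whence c = 0.  Omitting the index i leaves
a polynomial of degree at most 1 times exp(a_i u) with at least three zeros. *)
Lemma expgauss_zeros M (a : 'I_M -> R) (P : 'I_M -> {poly R}) (c : R)
    (z : seq R) :
  injective a -> (forall i, size (P i) <= 2)%N -> uniq z ->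
  (2 * M < size z)%N -> (forall u, u \in z -> expgauss a P c [::] u = 0) ->
  c = 0 /\ forall i, P i = 0.
Proof.
move=> a_inj size_P uniq_z size_z z0.
have shift0 i bs : (2 <= count_mem (a i) bs)%N ->
    shift_deriv (a i) bs (P i) = 0.
  move=> count_i; apply/eqP; rewrite -size_poly_leq0.
  rewrite (leq_trans (size_shift_deriv _ _ _))// leqn0 subn_eq0.
  exact: leq_trans (size_P i) count_i.
have c0 : c = 0.
  pose s := [seq a i | i <- enum 'I_M].
  have [z' [_ size_z' z'0]] := rolle_iter (s ++ s)
    (fun bs b u => is_derive_expgauss a P c bs b u) uniq_z z0.
  case: z' size_z' z'0 => [|u z'].
    by rewrite size_cat size_map size_enum_ord/=; lia.
  move=> _ /(_ u (mem_head _ _))/eqP.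
  rewrite /expgauss big1 ?add0r => [|i _]; last first.
    rewrite shift0 ?horner0 ?mul0r// count_cat.
    have a_s : a i \in s by rewrite map_f ?mem_enum.
    by move: a_s; rewrite -has_pred1 has_count; lia.
  rewrite big_cat/= -expr2 linearZ/= hornerZ -mulrA mulf_eq0 => /orP[/eqP//|].
  rewrite gt_eqF// mulr_gt0 ?expR_gt0//; apply: gsymb_sqr_gt0.
  by rewrite monic_neq0// monic_prod_XsubC.
split=> // i.
pose s := [seq a j | j <- enum 'I_M & j != i].
have size_s : (size s < M)%N.
  rewrite size_map size_filter -[X in (_ < X)%N]size_enum_ord.
  rewrite -(count_predC (pred1 i)) -[ltnLHS]add0n ltn_add2r -has_count.
  by rewrite has_pred1 mem_enum.
have [z' [uniq_z' size_z' z'0]] := rolle_iter (s ++ s)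
  (fun bs b u => is_derive_expgauss a P c bs b u) uniq_z z0.
have notin_s : a i \notin s ++ s.
  rewrite mem_cat orbb; apply/mapP => -[j]; rewrite mem_filter.
  by move=> /andP[ji _] /a_inj ij; rewrite ij eqxx in ji.
apply/eqP; rewrite -(shift_deriv_eq0 _ notin_s); apply: contraT => q_neq0.
have : (size z' < size (shift_deriv (a i) (s ++ s) (P i)))%N.
  apply: max_poly_roots => //; apply/allP => u /z'0 /eqP.
  rewrite /expgauss c0 scale0r linear0 horner0 mul0r addr0 (bigD1 i)//=.
  rewrite big1 => [|j ji].
    by rewrite addr0 mulf_eq0 [X in _ || X]gt_eqF ?expR_gt0// orbF.
  rewrite shift0 ?horner0 ?mul0r// count_cat.
  have a_s : a j \in s by rewrite map_f// mem_filter ji mem_enum.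
  by move: a_s; rewrite -has_pred1 has_count; lia.
have := leq_trans (size_shift_deriv (a i) (s ++ s) (P i)) (leq_subr _ _).
by have := size_P i; rewrite size_z' size_cat; lia.
Qed.

(** * Exponential sums and sign changes *)

Lemma IVT_sign_change (f : R -> R) x y : continuous f -> x < y ->
  f x * f y < 0 -> exists2 w, x < w < y & f w = 0.
Proof.
move=> cf lt_xy fxy.
have [||w] := @IVT R f x y 0 (ltW lt_xy).
- exact: continuous_subspaceT.
- rewrite ge_min le_max; nra.
rewrite in_itv/= => /andP[le_xw le_wy] fw0; exists w => //.
rewrite !lt_neqAle le_xw le_wy !andbT; apply/andP; split.
  by apply: contraTneq fxy => ->; rewrite fw0 mul0r ltxx.
by apply: contraTneq fxy => <-; rewrite fw0 mulr0 ltxx.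
Qed.

(** Going through the points from right to left, a zero is inserted exactly
where f changes sign.  It lies to the left of the points already treated, where
its factor is positive. *)
Lemma sign_by_zeros (f : R -> R) x l : continuous f -> path <%R x l ->
  (forall u, u \in x :: l -> f u != 0) ->
  exists z e, [/\ path <%R x z, forall u, u \in z -> f u = 0 &
    forall u, u \in x :: l -> 0 < e * f u * \prod_(w <- z) (u - w)].
Proof.
move=> cf; elim: l x => [|y l IH] x.
  move=> _ fx; exists [::], (f x); split=> // u; rewrite inE => /eqP ->.
  by rewrite big_nil mulr1 -expr2 exprn_even_gt0//= fx// mem_head.
move=> /= /andP[lt_xy path_l] f_neq0.
have [|z [e [path_z z0 pos]]] := IH y path_l.
  by move=> u u_l; apply: f_neq0; rewrite inE u_l orbT.
have path_xz : path <%R x z by apply: path_le path_z => //; exact: lt_trans.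
pose Q u := \prod_(w <- z) (u - w).
have Qxy : 0 < Q x * Q y.
  rewrite /Q -big_split/= big_seq; apply: prodr_gt0 => w w_z.
  have lt_yw : y < w.
    by move/order_path_min: path_z => /(_ lt_trans)/allP; apply.
  by rewrite -mulrNN mulr_gt0// oppr_gt0 subr_lt0// (lt_trans lt_xy).
have posy := pos y (mem_head _ _); rewrite -/(Q y) in posy.
have posxy : 0 < (e * f x * Q x) * (f x * f y).
  suff : 0 < (e * f x * Q x) * (f x * f y) * Q y ^+ 2.
    rewrite pmulr_lgt0// exprn_even_gt0//=.
    by apply: contraTneq posy => ->; rewrite mulr0 ltxx.
  rewrite (_ : _ * _ = (e * f y * Q y) * (Q x * Q y) * f x ^+ 2); last by ring.
  rewrite mulr_gt0 ?(mulr_gt0 posy)//.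
  by rewrite exprn_even_gt0//= f_neq0// mem_head.
(* No zero of the list separates x from y, so the sign at x of the quantity to
   bound is that of [f x * f y]. *)
have [fxy|fxy] := ltP 0 (f x * f y).
  exists z, e; split=> // u; rewrite inE => /predU1P[->|]; last exact: pos.
  by move: posxy; rewrite pmulr_lgt0.
have fxy_lt0 : f x * f y < 0.
  by rewrite lt_neqAle fxy andbT mulf_neq0 ?f_neq0 ?inE ?eqxx ?orbT.
have [w /andP[lt_xw lt_wy] fw0] := IVT_sign_change cf lt_xy fxy_lt0.
exists (w :: z), e; split.
- by rewrite /= lt_xw (path_le lt_trans lt_wy).
- by move=> u; rewrite inE => /predU1P[->//|]; exact: z0.
move=> u; rewrite inE big_cons mulrCA => /predU1P[->|u_l].
  rewrite nmulr_rgt0 ?subr_lt0// -/(Q x).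
  by move: posxy; rewrite nmulr_lgt0.
rewrite mulr_gt0 ?pos// subr_gt0 (lt_le_trans lt_wy)//.
move: u_l; rewrite inE => /predU1P[->//|u_l]; apply: ltW.
by move/order_path_min: path_l => /(_ lt_trans)/allP; apply.
Qed.

(** The product over bs is what the operators D - b, for b in bs, do to the
coefficient of exp(k v). *)
Definition expsum (s : seq R) (c : R -> R) bs (v : R) : R :=
  \sum_(k <- s) c k * (\prod_(b <- bs) (k - b)) * expR (k * v).

Lemma is_derive_expsum s c bs b (v : R) :
  is_derive v 1 (expsum s c bs) (expsum s c (b :: bs) v + b * expsum s c bs v).
Proof.
elim: s => [|k s IH].
  have -> : expsum [::] c bs = cst 0.
    by apply/funext => u; rewrite /expsum big_nil.
  by apply: is_derive_eq; rewrite /expsum !big_nil mulr0 addr0.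
pose g u := c k * (\prod_(b <- bs) (k - b)) * expR (k * u).
have -> : expsum (k :: s) c bs = g + expsum s c bs.
  by apply/funext => u; rewrite /expsum big_cons fctE.
have dg : is_derive v 1 g
    (c k * (\prod_(b <- b :: bs) (k - b)) * expR (k * v) + b * g v).
  by rewrite /g; apply: is_derive_eq; rewrite big_cons /GRing.scale/=; ring.
apply: is_derive_eq; rewrite /expsum [in RHS]big_cons fctE; ring.
Qed.

(** A form of Descartes' rule of signs.  The zeros z of f given by
[sign_by_zeros] are fewer than the zeros y of the exponential sum, so a zero
remains after applying the product of the D - z, whereas all the coefficients
have become of the same sign. *)
Lemma expsum_sign_changes (f c : R -> R) (s y : seq R) : continuous f ->
  (forall k, k \in s -> 0 < c k) -> uniq y ->
  (forall z, uniq z -> (forall u, u \in z -> f u = 0) -> (size z < size y)%N) ->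
  (forall v, v \in y -> \sum_(k <- s) c k * f k * expR (k * v) = 0) ->
  forall k, k \in s -> f k = 0.
Proof.
move=> cf c_gt0 uniq_y few_zeros sum0 k0 k0_s; apply/eqP/negPn/negP => fk0.
pose l := sort <=%R (undup [seq k <- s | f k != 0]).
have mem_l k : (k \in l) = (f k != 0) && (k \in s).
  by rewrite mem_sort mem_undup mem_filter.
have : sorted <%R l.
  by rewrite lt_sorted_uniq_le sort_uniq undup_uniq sort_le_sorted.
case l_eq : l => [|x l'] /= path_l.
  by have := mem_l k0; rewrite l_eq fk0 k0_s.
have [|z [e [path_z z0 pos]]] := @sign_by_zeros f x l' cf path_l.
  by move=> u; rewrite -l_eq mem_l => /andP[].
have uniq_z : uniq z by apply: lt_sorted_uniq; exact: path_sorted path_z.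
have G0 v : v \in y -> expsum s (fun k => c k * f k) [::] v = 0.
  by move=> /sum0 <-; apply: eq_bigr => k _; rewrite big_nil mulr1.
have [y' [_ size_y' y'0]] := rolle_iter z
  (fun bs b u => is_derive_expsum s (fun k => c k * f k) bs b u) uniq_y G0.
case: y' size_y' y'0 => [|v y'].
  by have := few_zeros z uniq_z z0; rewrite /=; lia.
move=> _ /(_ v (mem_head _ _)) /(congr1 ( *%R e))/eqP.
rewrite mulr0 /expsum mulr_sumr big_seq.
have term_ge0 k : k \in s ->
    0 <= e * (c k * f k * (\prod_(b <- z) (k - b)) * expR (k * v)) ?=
      iff (f k == 0).
  move=> k_s; apply/leifP.
  case: eqVneq => [->|fk]; first by rewrite mulr0 !mul0r mulr0.
  rewrite (_ : _ * _ = e * f k * (\prod_(b <- z) (k - b)) *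
    (c k * expR (k * v))); last by ring.
  by rewrite mulr_gt0 ?pos ?mulr_gt0 ?expR_gt0 ?c_gt0// -l_eq mem_l fk.
rewrite psumr_eq0 => [|k k_s]; last by case: (term_ge0 k k_s).
move=> /allP/(_ _ k0_s); rewrite k0_s/= eq_sym.
by case: (term_ge0 k0 k0_s) => _ ->; apply/negP.
Qed.

End zeros.

(** * Integration against a finitely supported measure *)

Section finite_support.
Context {R : realType} (S : {fset R}).
Context (P : {finite_measure set (measurableTypeR R) -> \bar R}).
Hypothesis P_supp : P (~` [set` S]) = 0%E.

Lemma integral_finite_support (f : measurableTypeR R -> R) :
  measurable_fun [set: measurableTypeR R] f ->
  (\int[P]_x (f x)%:E = (\sum_(s <- S) f s * fine (P [set s]))%:E)%E.
Proof.
move=> mf.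
have SE : [set` S] = \big[setU/set0]_(s <- S) [set s : measurableTypeR R].
  rewrite -bigcup_seq; apply/seteqP.
  by split=> [s Ss|s [s' Ss' ->]//]; exists s.
have mS : measurable ([set` S] : set (measurableTypeR R)).
  by rewrite SE; apply: bigsetU_measurable => s _; exact: measurable_set1.
have mEf (A : set (measurableTypeR R)) : measurable_fun A (fun x => (f x)%:E).
  by apply/measurable_EFinP; exact: measurable_funTS.
rewrite -(setUv [set` S]) integral_setU//; last 2 first.
- exact: measurableC.
- by apply/disj_setPS; rewrite setICr.
rewrite (null_set_integral (measurableC mS) (mEf _) P_supp) adde0 SE.
rewrite integral_bigsetU_EFin//; last first.
  apply/trivIsetP => s s' _ _ ss'; rewrite -subset0 => x [-> /= e].
  by rewrite e eqxx in ss'.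
rewrite -sumEFin; apply: eq_bigr => s _.
rewrite (eq_integral (cst (f s)%:E)) => [|x]; last by rewrite inE => ->.
by rewrite integral_cst// EFinM fineK// fin_num_measure.
Qed.

Lemma Rintegral_finite_support (f : R -> R) : continuous f ->
  \int[P]_x f x = \sum_(s <- S) f s * fine (P [set s]).
Proof.
move=> cf; rewrite /Rintegral integral_finite_support//.
exact: continuous_measurable_fun.
Qed.

Lemma Lfun_finite_support (f : R -> R) : continuous f -> f \in Lfun P 2%:E.
Proof.
move=> /continuous_measurable_fun mf.
rewrite inE; apply/andP; split; rewrite inE//= /finite_norm unlock poweR_lty//.
rewrite (integral_finite_support (f := fun x => `|f x| `^ 2)) ?ltry//.
apply: (measurableT_comp (f := fun x : R => x `^ 2)) => //.
exact: measurableT_comp.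
Qed.

End finite_support.

(** * The Gaussian kernel *)

Section gaussian.
Context {R : realType}.
Implicit Types s u : R.

Lemma is_derive_gaussianl u s :
  is_derive s 1 (gaussian_psf ^~ u) (- 2 * (s - u) * gaussian_psf s u).
Proof.
rewrite /gaussian_psf; apply: is_derive_eq; rewrite /GRing.scale/=; ring.
Qed.

Lemma derive1_gaussian s u :
  derive1 (gaussian_psf s) u = 2 * (s - u) * gaussian_psf s u.
Proof.
rewrite derive1E; suff [] : is_derive u 1 (gaussian_psf s)
    (2 * (s - u) * gaussian_psf s u) by [].
rewrite /gaussian_psf; apply: is_derive_eq; rewrite /GRing.scale/=; ring.
Qed.

(** This separates the variables up to the factor exp(2 s u), which turns
Gaussian mixtures into exponential sums. *)
Lemma gaussian_expM s u :
  gaussian_psf s u = expR (- s ^+ 2) * expR (- u ^+ 2) * expR (s * (2 * u)).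
Proof. by rewrite -!expRD; congr expR; ring. Qed.

Context (M : nat) (t : 'I_M -> R).

Lemma vvec_lshift s i :
  vvec gaussian_psf t s (lshift M i) 0 = gaussian_psf s (t i).
Proof. by rewrite /vvec col_mxEu mxE. Qed.

Lemma vvec_rshift s i : vvec gaussian_psf t s (rshift M i) 0 =
  2 * (s - t i) * gaussian_psf s (t i).
Proof. by rewrite /vvec col_mxEd mxE derive1_gaussian. Qed.

Lemma continuous_vvec i : continuous (fun s => vvec gaussian_psf t s i 0).
Proof.
case: (split_ordP i) => j ->.
  rewrite (_ : (fun _ => _) = gaussian_psf ^~ (t j)); last first.
    by apply/funext => s; rewrite vvec_lshift.
  by apply: is_derive_continuous => s; exact: is_derive_gaussianl.
rewrite (_ : (fun _ => _) =
    fun s => 2 * (s - t j) * gaussian_psf s (t j)); last first.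
  by apply/funext => s; rewrite vvec_rshift.
apply: is_derive_continuous => s; exact: is_deriveM.
Qed.

Definition vcombo (c : 'rV[R]_(M + M)) (g s : R) : R :=
  \sum_i c 0 i * vvec gaussian_psf t s i 0 + g.

Definition vcombo_poly (c : 'rV[R]_(M + M)) (i : 'I_M) : {poly R} :=
  expR (- t i ^+ 2) *: ((c 0 (lshift M i))%:P +
    (2 * c 0 (rshift M i)) *: ('X - (t i)%:P)).

(** Because exp(s^2) exp(- (s - t)^2) = exp(- t^2) exp(2 t s). *)
Lemma vcombo_expgauss c g s : vcombo c g s * expR (s ^+ 2) =
  expgauss (fun i => 2 * t i) (vcombo_poly c) g [::] s.
Proof.
rewrite /vcombo /expgauss big_nil -[g *: 1]mul_polyC mulr1.
rewrite gsymbC hornerC mulrDl.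
congr (_ + _); rewrite big_split_ord/= -big_split/= mulr_suml.
apply: eq_bigr => i _; rewrite vvec_lshift vvec_rshift !gaussian_expM.
rewrite hornerZ hornerD hornerC hornerZ hornerXsubC.
rewrite [s * _]mulrC.
have := expRxMexpNx_1 (s ^+ 2).
set x := expR (s ^+ 2); set y := expR (- s ^+ 2) => xy.
rewrite -[RHS]mul1r -xy; ring.
Qed.

Lemma vcombo_zeros c g (z : seq R) : injective t -> uniq z ->
  (2 * M < size z)%N -> (forall s, s \in z -> vcombo c g s = 0) ->
  c = 0 /\ g = 0.
Proof.
move=> t_inj uniq_z size_z z0.
have [|||-> P0] := @expgauss_zeros _ _ (fun i => 2 * t i)
  (vcombo_poly c) g z _ _ uniq_z size_z.
- by move=> i j /mulfI; rewrite pnatr_eq0 => /(_ isT)/t_inj.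
- move=> i; rewrite (leq_trans (size_scale_leq _ _))//.
  rewrite (leq_trans (size_polyD _ _))// geq_max size_polyC.
  rewrite (leq_trans (size_scale_leq _ _)) ?size_XsubC// andbT.
  by case: (_ != 0).
- by move=> s /z0 vs0; rewrite -vcombo_expgauss vs0 mul0r.
split=> //; have l0 i : c 0 (lshift M i) = 0.
  have /(congr1 (horner^~ (t i)))/eqP := P0 i.
  rewrite /vcombo_poly !hornerE subrr mulr0 addr0 mulf_eq0.
  by rewrite gt_eqF ?expR_gt0//= => /eqP.
have r0 i : c 0 (rshift M i) = 0.
  have /(congr1 (horner^~ (t i + 1)))/eqP := P0 i.
  rewrite /vcombo_poly l0 hornerZ hornerD hornerC hornerZ hornerXsubC.
  rewrite add0r (_ : t i + 1 - t i = 1); last by ring.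
  rewrite mulr1 !mulf_eq0 gt_eqF ?expR_gt0//= pnatr_eq0/=.
  by move=> /eqP.
by apply/rowP => i; rewrite mxE; case: (split_ordP i) => j ->.
Qed.

Context (S : {fset R}) (P : {finite_measure set (measurableTypeR R) -> \bar R}).
Hypothesis P_supp : P (~` [set` S]) = 0%E.
Hypothesis P_pos : forall s : R, s \in S -> (0 < P [set s])%E.
Hypothesis S_size : (2 * M < #|` S|)%N.

Let mass s := fine (P [set s]).

Lemma mass_gt0 s : s \in S -> 0 < mass s.
Proof.
by move=> s_S; rewrite fine_gt0// P_pos//= ltey_eq fin_num_measure.
Qed.

Lemma continuous_gaussianl u : continuous (gaussian_psf ^~ u).
Proof. exact: is_derive_continuous (is_derive_gaussianl u). Qed.

Lemma weightE u :
  weight P gaussian_psf u = \sum_(s <- S) gaussian_psf s u * mass s.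
Proof.
by apply: Rintegral_finite_support => //; exact: continuous_gaussianl.
Qed.

Lemma weight_gt0 u : 0 < weight P gaussian_psf u.
Proof.
have [s0 s0_S] : exists s, s \in S.
  by apply/fset0Pn; rewrite -cardfs_gt0; apply: leq_ltn_trans S_size.
have term_gt0 s : s \in S -> 0 < gaussian_psf s u * mass s.
  by move=> s_S; rewrite mulr_gt0 ?expR_gt0 ?mass_gt0.
rewrite weightE big_seq lt0r sumr_ge0 ?andbT => [|s /term_gt0/ltW//].
rewrite psumr_eq0 => [|s /term_gt0/ltW//].
by apply/negP => /allP/(_ _ s0_S); rewrite s0_S gt_eqF ?term_gt0.
Qed.

Lemma kappaE u i : kappa P gaussian_psf t u i 0 = (weight P gaussian_psf u)^-1 *
  \sum_(s <- S) gaussian_psf s u * vvec gaussian_psf t s i 0 * mass s.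
Proof.
rewrite /kappa !mxE; congr (_ * _).
rewrite (Rintegral_finite_support P_supp)//.
exact: (continuous_mul (continuous_gaussianl (u := u))
  (continuous_vvec (i := i))).
Qed.

Lemma gramE i j : gram P gaussian_psf t i j =
  \sum_(s <- S) vvec gaussian_psf t s i 0 * vvec gaussian_psf t s j 0 * mass s.
Proof.
rewrite /gram mxE.
have -> : (fun s => (vvec gaussian_psf t s *m (vvec gaussian_psf t s)^T) i j) =
    (fun s => vvec gaussian_psf t s i 0 * vvec gaussian_psf t s j 0).
  by apply/funext => s; rewrite mxE big_ord1 [X in _ * X]mxE.
rewrite (Rintegral_finite_support P_supp)//.
exact: (continuous_mul (continuous_vvec (i := i)) (continuous_vvec (i := j))).
Qed.

Hypothesis t_inj : injective t.

Lemma gaussian_independence : independence P gaussian_psf t.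
Proof.
rewrite /independence -row_free_unit; apply: inj_row_free => c cG0.
have [|//] := @vcombo_zeros c 0 S t_inj (fset_uniq S) S_size.
(* The quadratic form of the Gram matrix at c is a sum of nonnegative terms, so
   its vanishing forces the combination to vanish at every point of S. *)
have : \sum_(s <- S) vcombo c 0 s ^+ 2 * mass s = 0.
  transitivity (\sum_j (c *m gram P gaussian_psf t) 0 j * c 0 j); last first.
    by rewrite cG0 big1// => j _; rewrite mxE mul0r.
  transitivity (\sum_(s <- S) \sum_j \sum_i c 0 i *
      (vvec gaussian_psf t s i 0 * vvec gaussian_psf t s j 0 * mass s) * c 0 j).
    apply: eq_bigr => s _; rewrite /vcombo addr0 expr2 mulr_sumr.
    rewrite mulr_suml; apply: eq_bigr => j _.
    by rewrite !mulr_suml; apply: eq_bigr => i _; ring.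
  rewrite exchange_big; apply: eq_bigr => j _.
  rewrite exchange_big mxE mulr_suml; apply: eq_bigr => i _.
  by rewrite gramE mulr_sumr mulr_suml.
move=> sum0 s s_S; move: sum0 => /eqP; rewrite big_seq psumr_eq0 => [|s' s'_S].
  move=> /allP/(_ _ s_S); rewrite s_S/= mulf_eq0 (gt_eqF (mass_gt0 s_S)) orbF.
  by rewrite sqrf_eq0 => /eqP.
by rewrite mulr_ge0 ?sqr_ge0// ltW// mass_gt0.
Qed.

(** Orthogonality to the Gaussian centred at u means that an exponential sum
vanishes at 2 u, so that Descartes' rule applies: either the combination has
more than 2M zeros on the line, or it vanishes on the whole of S. *)
Lemma vcombo_orthogonal c g (x : seq R) : uniq x -> (2 * M < size x)%N ->
  (forall u, u \in x ->
     \sum_(s <- S) gaussian_psf s u * vcombo c g s * mass s = 0) ->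
  c = 0 /\ g = 0.
Proof.
move=> uniq_x size_x x0.
have [[z [uniq_z size_z z0]]|few] := pselect (exists z : seq R,
    [/\ uniq z, (2 * M < size z)%N & forall s, s \in z -> vcombo c g s = 0]).
  exact: vcombo_zeros z0.
apply: (@vcombo_zeros c g S) => // [|s s_S]; first exact: fset_uniq.
pose f s := vcombo c g s * expR (s ^+ 2).
have vcombo0 s' : f s' = 0 -> vcombo c g s' = 0.
  by move/eqP; rewrite mulf_eq0 [X in _ || X]gt_eqF ?expR_gt0// orbF => /eqP.
apply: (vcombo0 s).
apply: (@expsum_sign_changes _ f (fun s => mass s * expR (- s ^+ 2) ^+ 2) S
  [seq 2 * u | u <- x]) s_S.
- rewrite (_ : f = expgauss (fun i => 2 * t i) (vcombo_poly c) g [::]).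
    by apply: is_derive_continuous => u; exact: is_derive_expgauss 0 _.
  by apply/funext => u; exact: vcombo_expgauss.
- by move=> k k_S; rewrite mulr_gt0 ?mass_gt0// exprn_gt0 ?expR_gt0.
- by rewrite map_inj_uniq// => u v /mulfI; apply; rewrite pnatr_eq0.
- move=> z uniq_z z0; rewrite size_map ltnNge; apply/negP => size_z.
  apply: few; exists z; split=> [//||s' /z0/vcombo0//].
  exact: leq_trans size_x size_z.
move=> _ /mapP[u /x0 sum0 ->].
have /eqP : expR (- u ^+ 2) *
    \sum_(k <- S) mass k * expR (- k ^+ 2) ^+ 2 * f k * expR (k * (2 * u)) = 0.
  rewrite -[RHS]sum0 mulr_sumr; apply: eq_bigr => k _.
  rewrite gaussian_expM /f; have := expRxMexpNx_1 (k ^+ 2).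
  set a := expR (k ^+ 2); set b := expR (- k ^+ 2) => ab.
  by rewrite -[RHS]mul1r -ab; ring.
by rewrite mulf_eq0 gt_eqF ?expR_gt0//= => /eqP.
Qed.

Lemma size_points (tm tp : 'I_M -> R) u :
  size (points tm tp u) = (M + M + 1)%N.
Proof.
rewrite /points size_rcons size_flatten /shape -map_comp sumnE big_map.
by rewrite big_enum/= sum_nat_const card_ord; lia.
Qed.

Lemma gaussian_determinantal T : determinantal P gaussian_psf t T.
Proof.
exists 1 => // tm tp _ _ u _ uniq_p; set p := points tm tp u in uniq_p *.
rewrite -row_free_unit; apply: inj_row_free => v.
rewrite -[v]hsubmxK; move: (lsubmx v) (rsubmx v) => {v} c d.
rewrite /Lambda mul_row_col => v0.
have size_p : size p = (M + M + 1)%N := size_points tm tp u.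
have [|w w_p|c0 d0] := @vcombo_orthogonal c (d 0 0) p uniq_p.
- by rewrite size_p; lia.
- have lt_w : (index w p < M + M + 1)%N by rewrite -size_p index_mem.
  have /(congr1 (fun A : 'rV[R]_(M + M + 1) => A 0 (Ordinal lt_w))) := v0.
  rewrite !mxE big_ord1 mxE mulr1.
  under eq_bigr do rewrite mxE/= nth_index// kappaE mulrCA.
  rewrite -mulr_sumr => /(congr1 ( *%R (weight P gaussian_psf w))).
  (* Clearing the denominator [weight w] of [kappa w] makes the last row of
  [Lambda], the constant 1, appear as the integral of the Gaussian itself. *)
  rewrite mulr0 mulrDr mulVKf ?gt_eqF ?weight_gt0// => w0.
  rewrite -[RHS]w0 weightE mulr_suml.
  under [in RHS]eq_bigr do rewrite mulr_sumr.
  rewrite [in RHS]exchange_big/= -big_split/=; apply: eq_bigr => s _.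
  rewrite /vcombo mulrDr mulrDl mulr_sumr mulr_suml.
  by congr (_ + _); [apply: eq_bigr => i _; ring|ring].
by rewrite c0 [d]mx11_scalar d0 raddf0 row_mx0.
Qed.

End gaussian.

Theorem theorem1p3 (R : realType) (M : nat) (T : R) (S : {fset R})
  (P : {finite_measure set (measurableTypeR R) -> \bar R})
  (t : 'I_M -> R)
  (hM : (1 <= M)%N) (hT : 0 < T)
  (hS : (2 * M < #|` S|)%N)
  (hP_supp : P (~` [set` S]) = 0%E)
  (hP_pos : forall s : R, s \in S -> (0 < P [set s])%E)
  (ht : forall i j : 'I_M, (i < j)%N -> t i < t j) :
  [/\ integrability P gaussian_psf,
      positivity P gaussian_psf T,
      independence P gaussian_psf t
    & determinantal P gaussian_psf t T].
Proof.
have t_inj : injective t.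
  move=> i j tij; apply/val_inj/eqP.
  by case: ltngtP => // /ht; rewrite tij ltxx.
split.
- move=> u; apply: Lfun_finite_support hP_supp _ _.
  exact: continuous_gaussianl.
- by move=> u _; exact: weight_gt0 hP_supp hP_pos hS u.
- exact: gaussian_independence hP_supp hP_pos hS t_inj.
- exact: gaussian_determinantal hP_supp hP_pos hS t_inj T.
Qed.
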